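(* There exists a $5$-chromatic tournament on $19$ vertices.
   Context: A tournament is an orientation of a complete graph. A $k$-coloring of a digraph is a partition of its vertex set into $k$ classes each inducing an acyclic subdigraph (for tournaments: each class induces a transitive subtournament); the chromatic number is the least such $k$, and a digraph is $k$-chromatic if its chromatic number equals $k$. *)

(* Defs.v *)
From mathcomp Require Import all_boot.

Set Implicit Arguments.
Unset Strict Implicit.
Unset Printing Implicit Defensive.

(* A digraph is a finite type of vertices with its arc relation [e]. *)

Definition tournament (T : finType) (e : rel T) : Prop :=
  irreflexive e /\ forall x y : T, x != y -> e x y (+) e y x.

(* [ucycle e c]: [c] lists the distinct vertices of a directed cycle. The empty
   sequence is vacuously a cycle, so it is the one that must be excluded. *)
Definition acyclic (T : finType) (e : rel T) (A : {set T}) : Prop :=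
  forall c : seq T, c != [::] -> {subset c <= A} -> ~ ucycle e c.

(* Library partitions have nonempty blocks; the least [k] is the same as when
   empty classes are allowed. *)
Definition coloring (T : finType) (e : rel T) (k : nat) (P : {set {set T}}) :
    Prop :=
  [/\ partition P [set: T], #|P| = k & forall A, A \in P -> acyclic e A].

Definition colorable (T : finType) (e : rel T) (k : nat) : Prop :=
  exists P : {set {set T}}, coloring e k P.

Definition chromatic (T : finType) (e : rel T) (k : nat) : Prop :=
  colorable e k /\ forall m : nat, colorable e m -> k <= m.

(* Main.v *)
Require Import Defs.
From mathcomp Require Import all_boot.

(** Replace six vertices of the Paley tournament on [7] vertices by cyclic
    triangles, keeping the seventh. In a coloring of the resulting
    [19]-vertex tournament, each color meets at most three of the seven blocks,
    since every four vertices of the Paley tournament contain a cyclic triangle;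
    and each of the six triangles needs two colors. So with [m] colors there are
    at least [6 * 2 + 1 = 13] and at most [3 * m] incidences between colors and
    blocks, whence [m >= 5]. *)

Set Implicit Arguments.
Unset Strict Implicit.
Unset Printing Implicit Defensive.

(** [1], [2], [4] are the nonzero squares modulo [7]; the added [7] keeps the truncated subtraction
    exact for residues. *)
Definition paley7 (a b : nat) : bool := (b + 7 - a) %% 7 \in [:: 1; 2; 4].

(* The block of [x] is [x %/ 3]; the block [6] is the single vertex [18]. *)
Definition blown_paley7_nat (i j : nat) : bool :=
  if i %/ 3 == j %/ 3 then (j + 3 - i) %% 3 == 1 else paley7 (i %/ 3) (j %/ 3).

Definition blown_paley7 : rel 'I_19 := fun x y => blown_paley7_nat x y.

(** Reduces claims about all ordinals to boolean checks on [nat], which [vm_compute] can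
    evaluate. *)
Lemma all_ordP n (p : pred nat) :
  reflect (forall i : 'I_n, p i) (all p (iota 0 n)).
Proof.
apply: (iffP allP) => [h i|h i]; first by apply: h; rewrite mem_iota ltn_ord.
by rewrite mem_iota => lt_in; apply: (h (Ordinal lt_in)).
Qed.

Lemma blown_paley7_tournament : tournament blown_paley7.
Proof.
split=> [x|x y].
  by rewrite /blown_paley7 /blown_paley7_nat eqxx addKn.
pose p (i j : nat) :=
  (i != j) ==> blown_paley7_nat i j (+) blown_paley7_nat j i.
have /all_ordP/(_ x)/all_ordP/(_ y)/implyP :
  all (fun i => all (p i) (iota 0 19)) (iota 0 19) by vm_compute.
exact.
Qed.

(** Along a cycle the rank would increase strictly and yet return to its initial value. *)
Lemma ranked_acyclic (T : finType) (e : rel T) (r : T -> nat) (A : {set T}) :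
  {in A &, forall x y, e x y -> r x < r y} -> acyclic e A.
Proof.
move=> r_incr [//|x c] _ sub_cA /andP[cyc_c _].
have: path (relpre r ltn) x (rcons c x).
  apply: sub_in_path cyc_c; first exact: r_incr.
  apply/allP=> y; rewrite -rcons_cons mem_rcons inE => /orP[/eqP->|].
    by apply: sub_cA; rewrite mem_head.
  exact: sub_cA.
rewrite -path_map map_rcons => /(order_path_min ltn_trans)/allP.
by move/(_ (r x)); rewrite mem_rcons mem_head ltnn => /(_ isT).
Qed.

Lemma ranked_colorable (T : finType) (e : rel T) (r : T -> nat) (k : nat)
    (f : T -> 'I_k) :
  (forall c, exists x, f x = c) ->
  (forall x y, f x = f y -> e x y -> r x < r y) -> colorable e k.
Proof.
move=> f_surj r_incr; pose F c := [set x | f x == c].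
(* Surjectivity of [f] makes the fibres nonempty; being disjoint too, they are distinct, so there
   are exactly [k] classes. *)
have [||trivP injF] := @trivIimset T 'I_k predT F.
- move=> c d _ _ neq_dc; rewrite -setI_eq0; apply/eqP/setP=> x; rewrite !inE.
  by apply: contraNF neq_dc => /andP[/eqP <- /eqP <-].
- apply/imsetP=> -[c _ /setP F0]; have [x fx] := f_surj c.
  by have := F0 x; rewrite !inE fx eqxx.
exists [set F c | c in predT]; split.
- apply/and3P; split=> //.
  + apply/eqP/setP=> x; rewrite inE; apply/bigcupP.
    by exists (F (f x)); rewrite ?imset_f ?inE.
  + apply/imsetP=> -[c _ /setP F0]; have [x fx] := f_surj c.
    by have := F0 x; rewrite !inE fx eqxx.
- by rewrite card_in_imset // card_ord.
- move=> _ /imsetP[c _ ->]; apply: (@ranked_acyclic _ _ r) => x y.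
  by rewrite !inE => /eqP fx /eqP fy; apply: r_incr; rewrite fx fy.
Qed.

Lemma blown_paley7_colorable : colorable blown_paley7 5.
Proof.
(* Blocks [0, 1, 2] and blocks [3, 4, 5] form transitive triples of the Paley
   tournament, so each can be split into classes of sizes [6] and [3] on which
   the arcs increase; [18] has the fifth color. *)
pose h x := x %/ 9 * 2 + (x %% 3 == 2).
have lt_h (x : 'I_19) : h x < 5.
  have /all_ordP/(_ x) : all (fun i => h i < 5) (iota 0 19) by vm_compute.
  exact.
apply: (@ranked_colorable _ _ val _ (fun x => Ordinal (lt_h x))) => [c|x y].
  have /all_ordP/(_ c)/hasP[i] :
    all (fun j => has (fun i => h i == j) (iota 0 19)) (iota 0 5) by vm_compute.
  rewrite mem_iota => lt_i /eqP hi.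
  by exists (Ordinal lt_i); apply: val_inj.
case=> hxy exy.
pose p (i j : nat) := (h i == h j) ==> blown_paley7_nat i j ==> (i < j).
have /all_ordP/(_ x)/all_ordP/(_ y) :
  all (fun i => all (p i) (iota 0 19)) (iota 0 19) by vm_compute.
by rewrite /p hxy eqxx implyTb => /implyP; apply.
Qed.

Definition block (x : 'I_19) : 'I_7 := inord (x %/ 3).

Lemma blockE x : block x = x %/ 3 :> nat.
Proof. by rewrite inordK // ltn_divLR // (leq_trans (ltn_ord x)). Qed.

Lemma block_arc x y : paley7 (block x) (block y) -> blown_paley7 x y.
Proof.
rewrite /blown_paley7 /blown_paley7_nat !blockE; case: eqP => // ->.
by rewrite /paley7 addKn modnn.
Qed.

Lemma acyclicN3 (T : finType) (e : rel T) (A : {set T}) (x y z : T) :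
    irreflexive e -> acyclic e A -> x \in A -> y \in A -> z \in A ->
  ~~ [&& e x y, e y z & e z x].
Proof.
move=> e_irr acycA xA yA zA; apply/negP=> /and3P[exy eyz ezx].
apply: (acycA [:: x; y; z]) => // [t|].
  by rewrite !inE => /or3P[] /eqP->.
rewrite /ucycle /= exy eyz ezx /= !inE negb_or !andbT -andbA.
(* If two of the vertices coincided, one of the three arcs would be a loop. *)
apply/and3P; split; apply/eqP=> eq_v.
- by rewrite eq_v e_irr in exy.
- by rewrite eq_v e_irr in ezx.
- by rewrite eq_v e_irr in eyz.
Qed.

(** Each out-neighborhood is a cyclic triangle, a translate of [1 -> 2 -> 4 -> 1], so no four
    vertices are transitive. The proof checks all quadruples by computation. *)
Lemma paley7_four (a b c d : 'I_7) :
  uniq [:: a; b; c; d] ->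
  exists2 s : 'I_7 * 'I_7 * 'I_7,
    all (mem [:: a; b; c; d]) [:: s.1.1; s.1.2; s.2]
    & [&& paley7 s.1.1 s.1.2, paley7 s.1.2 s.2 & paley7 s.2 s.1.1].
Proof.
pose cyc (i j k : nat) := [&& paley7 i j, paley7 j k & paley7 k i].
pose p (a b c d : nat) := uniq [:: a; b; c; d] ==>
  has (fun i => has (fun j => has (cyc i j) [:: a; b; c; d]) [:: a; b; c; d])
    [:: a; b; c; d].
have /all_ordP/(_ a)/all_ordP/(_ b)/all_ordP/(_ c)/all_ordP/(_ d) :
    all (fun a => all (fun b => all (fun c => all (p a b c)
      (iota 0 7)) (iota 0 7)) (iota 0 7)) (iota 0 7) by vm_compute.
rewrite /p -[[:: val a; _; _; _]]/(map val [:: a; b; c; d]).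
rewrite (map_inj_uniq val_inj) => /implyP/[apply].
case/hasP=> _ /mapP[i i_s ->] /hasP[_ /mapP[j j_s ->]] /hasP[_ /mapP[k k_s ->]].
by exists (i, j, k); rewrite /= ?i_s ?j_s ?k_s.
Qed.

(** A cyclic triangle among four blocks met by [A] lifts to one inside [A], by choosing any
    representatives. *)
Lemma acyclic_blocks (A : {set 'I_19}) :
  acyclic blown_paley7 A -> #|block @: A| <= 3.
Proof.
have [irr _] := blown_paley7_tournament.
move=> acycA; rewrite leqNgt cardE; apply/negP.
have: {subset enum (block @: A) <= block @: A} by move=> q; rewrite mem_enum.
case: (enum _) (enum_uniq (block @: A)) => [|a [|b [|c [|d s]]]] //.
rewrite -[_ :: _]/([:: a; b; c; d] ++ s) cat_uniq => /and3P[uniq4 _ _] sub _.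
have [[[i j] k] /= /and4P[i_s j_s k_s _] cyc] := paley7_four uniq4.
have in_A q : q \in [:: a; b; c; d] -> q \in block @: A.
  by move=> q_s; apply: sub; rewrite mem_cat q_s.
case/imsetP: (in_A _ i_s) cyc => x xA ->.
case/imsetP: (in_A _ j_s) => y yA ->; case/imsetP: (in_A _ k_s) => z zA ->.
case/and3P=> /block_arc xy /block_arc yz /block_arc zx.
by have := acyclicN3 irr acycA xA yA zA; rewrite xy yz zx.
Qed.

Definition meeting (P : {set {set 'I_19}}) (q : 'I_7) : {set {set 'I_19}} :=
  [set A in P | q \in block @: A].

Lemma pblock_meeting (m : nat) (P : {set {set 'I_19}}) (x : 'I_19) :
  coloring blown_paley7 m P -> pblock P x \in meeting P (block x).
Proof.
move=> [/and3P[/eqP covP _ _] _ _].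
have x_cov : x \in cover P by rewrite covP inE.
by rewrite inE pblock_mem // imset_f // mem_pblock.
Qed.

Lemma card_meeting_gt1 (m : nat) (P : {set {set 'I_19}}) (q : 'I_7) :
  coloring blown_paley7 m P -> q < 6 -> 1 < #|meeting P q|.
Proof.
move=> colP q_lt6; have [/and3P[/eqP covP _ _] _ acycP] := colP.
have [irr _] := blown_paley7_tournament.
have lt19 i : i < 3 -> q * 3 + i < 19.
  move=> lt_i3; apply: (@leq_trans (q.+1 * 3)).
    by rewrite mulSn addnC ltn_add2r.
  by apply: (@leq_trans (6 * 3)); rewrite ?leq_mul2r.
pose v i (lt_i3 : i < 3) := Ordinal (lt19 i lt_i3).
have block_v i lt_i3 : block (@v i lt_i3) = q.
  by apply: ord_inj; rewrite blockE divnMDl // divn_small // addn0.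
pose v0 := @v 0 isT; pose v1 := @v 1 isT; pose v2 := @v 2 isT.
have cyc : [&& blown_paley7 v0 v1, blown_paley7 v1 v2 & blown_paley7 v2 v0].
  (* Within a block the offset [q * 3] cancels, leaving the cycle [0 -> 1 -> 2 -> 0]. *)
  rewrite /blown_paley7 /blown_paley7_nat -!blockE !block_v eqxx /=.
  by rewrite -!addnA !subnDl.
have meet i lt_i3 : pblock P (@v i lt_i3) \in meeting P q.
  by have := pblock_meeting (@v i lt_i3) colP; rewrite block_v.
have mono : ~~ ((pblock P v0 == pblock P v1) && (pblock P v0 == pblock P v2)).
  apply/negP=> /andP[/eqP eq01 /eqP eq02].
  have v_cov x : x \in cover P by rewrite covP inE.
  have := acyclicN3 (x := v0) (y := v1) (z := v2) irr
            (acycP _ (pblock_mem (v_cov v0))).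
  rewrite (mem_pblock P v0) {1}eq01 eq02 !mem_pblock !v_cov cyc.
  by move=> /(_ isT isT isT).
(* The color of [v0] differs from that of [v1] or of [v2], which gives two colors in the block. *)
case/nandP: mono => neq; apply/card_gt1P.
- by exists (pblock P v0), (pblock P v1); split; rewrite ?meet.
- by exists (pblock P v0), (pblock P v2); split; rewrite ?meet.
Qed.

Lemma incidences_ge (m : nat) (P : {set {set 'I_19}}) :
  coloring blown_paley7 m P -> 13 <= \sum_(A in P) #|block @: A|.
Proof.
move=> colP.
have -> : \sum_(A in P) #|block @: A| = \sum_(q < 7) #|meeting P q|.
  (* Double counting: incidences are summed by block instead of by color. *)
  under eq_bigr => A _ do rewrite -sum1_card big_mkcond.
  rewrite exchange_big; apply: eq_bigr => q _ /=.
  by rewrite -sum1_card -big_mkcondr; apply: eq_bigl => A; rewrite inE.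
have sum13 : \sum_(q < 6) 2 + 1 = 13 by rewrite sum_nat_const card_ord.
rewrite big_ord_recr -{1}sum13; apply: leq_add.
  by apply: leq_sum => q _; apply: (card_meeting_gt1 colP); apply: (ltn_ord q).
(* [ord_max] is here the vertex [18], whose block is [6], the [ord_max] of ['I_7]. *)
apply/card_gt0P; exists (pblock P ord_max).
suff <- : block ord_max = ord_max by apply: pblock_meeting colP.
by apply: ord_inj; rewrite blockE.
Qed.

Lemma blown_paley7_coloring_ge5 (m : nat) (P : {set {set 'I_19}}) :
  coloring blown_paley7 m P -> 5 <= m.
Proof.
move=> colP; have [_ <- acycP] := colP.
rewrite ltnNge; apply: contraL (incidences_ge colP) => cardP.
rewrite -ltnNge.
(* Four colors would give at most [4 * 3 = 12] incidences, one too few. *)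
apply: (@leq_ltn_trans (\sum_(A in P) 3)).
  by apply: leq_sum => A /acycP/acyclic_blocks.
by rewrite sum_nat_const ltnS -[12]/(4 * 3) leq_mul2r.
Qed.

Theorem theorem5p1 :
  exists e : rel 'I_19, tournament e /\ chromatic e 5.
Proof.
exists blown_paley7; split; first exact: blown_paley7_tournament.
split; first exact: blown_paley7_colorable.
by move=> m [P]; apply: blown_paley7_coloring_ge5.
Qed.
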